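(* Assume UH is nonparametric. Let $N\subseteq\mathcal{A}\subseteq\mathbb{R}^{d_\alpha}$ be open, let $\alpha_r\in N$, and let $r(\alpha)=1(\alpha\le\alpha_r)$ (componentwise inequality), $\phi(\eta_0)=\mathbb{E}_{\eta_0}[1(\alpha\le\alpha_r)]$. Assume: (i) $\alpha\mapsto f_{z/\alpha}(z)$ is continuous on $N$ for $\mu$-a.e. $z$; (ii) for every $\alpha\in N$ there exists a neighborhood $\Gamma_0\subset N$ of $\alpha$ such that for all $s\in L_2^0(\mathbb{P})$ satisfying $r(\alpha)-\phi(\eta_0)=\int s(z)f_{z/\alpha}(z)\,d\mu(z)$ ($\eta_0$-a.s.), $$\int |s(z)|\sup_{\alpha\in\Gamma_0}f_{z/\alpha}(z)\,d\mu(z)<\infty .$$ Then the CDF value $\phi(\eta_0)$ is not regularly identified.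
   Context: Setting: $Z$ is observed; $\alpha$ (unobserved heterogeneity, UH) is unobserved with unknown distribution $\eta_0$ belonging to a class $H$ of distributions on $\mathcal{A}\subseteq\mathbb{R}^{d_\alpha}$, and $\mathcal{A}$ is the support of $\eta_0$. $Z$ has law $\mathbb{P}$ with density $f_{\eta_0}(z)=\int_{\mathcal{A}}f_{z/\alpha}(z)\,d\eta_0(\alpha)$ with respect to a $\sigma$-finite measure $\mu$, where $f_{z/\alpha}$ is the known conditional density of $Z$ given $\alpha$. $L_2^0(\nu)$ denotes the zero-$\nu$-mean functions in $L_2(\nu)$. Tangent space: a path $\eta_t\in H$, $t\in[0,\varepsilon)$, has score $b\in L_2(\eta_0)$ if $\int[(d\eta_t^{1/2}-d\eta_0^{1/2})/t-\tfrac12 b\,d\eta_0^{1/2}]^2\to0$ as $t\downarrow0$. $T(\eta_0)$ is the linear span of all such scores $b$. UH is nonparametric if $T(\eta_0)$ is dense in $L_2^0(\eta_0)$. Regular identification: the score operator is $Ab=\mathbb{E}[b(\alpha)\mid Z]$. For a moment functional $\phi(\eta)=\mathbb{E}_\eta[r(\alpha)]$ with gradient $r_\phi=r-\phi(\eta_0)$, the efficiency bound is $\sup_{b\in T(\eta_0)}(\mathbb{E}_{\eta_0}[r_\phi b])^2/\mathbb{E}[(Ab(Z))^2]$ (with $0/0=0$ and $c/0=\infty$ for $c>0$). $\phi(\eta_0)$ is regularly identified if it is identified ($f_\eta=f_{\eta_0}$ $\mu$-a.e., $\eta\in H$, implies $\phi(\eta)=\phi(\eta_0)$) with a finite efficiency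 bound. *)

(* Defs.v *)
From HB Require Import structures.
From mathcomp Require Import all_boot all_order all_algebra.
From mathcomp Require Import all_classical all_reals all_analysis.
Set Implicit Arguments.
Unset Strict Implicit.
Unset Printing Implicit Defensive.
Import Order.TTheory GRing.Theory Num.Theory.
Import numFieldNormedType.Exports.
Local Open Scope classical_set_scope.
Local Open Scope ring_scope.

(* R^d with its Borel sigma-algebra; the carrier is 'rV[R]_d itself, so that
   functions and sets on 'rV[R]_d can be used where this type is expected. *)
Notation borel_rV R d := (g_sigma_algebraType (@open 'rV[R]_d)).

(* Topological support; the library has none for measures. *)
Definition msupport (R : realType) (n : nat)
    (eta : {measure set (borel_rV R n) -> \bar R}) : set 'rV[R]_n :=
  [set a | forall U : set 'rV[R]_n, open U -> U a -> (0 < eta U)%E].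

Definition L20 d (T : measurableType d) (R : realType) (nu : probability T R) :
    set (T -> R) :=
  [set g | g \in Lfun nu 2%:E /\ ('E_nu[g] = 0)%E].

Definition dense_in_L20 d (T : measurableType d) (R : realType)
    (nu : probability T R) (S : set (T -> R)) : Prop :=
  forall g, L20 nu g ->
  forall e : R, 0 < e ->
  exists2 b, S b & ('N[nu]_2%:E[EFin \o (g \- b)%R] < e%:E)%E.

Definition lin_span (T : Type) (R : realType) (S : set (T -> R)) :
    set (T -> R) :=
  [set b | exists (n : nat) (c : 'I_n -> R) (v : 'I_n -> T -> R),
     (forall i, S (v i)) /\ b = (fun x => \sum_(i < n) c i * v i x)].

(* g(Y) is a version of E[X | Y]. *)
Definition is_cond_exp d1 d2 (Omega : measurableType d1)
    (T : measurableType d2) (R : realType) (Pr : probability Omega R)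
    (X : Omega -> R) (Y : {mfun Omega >-> T}) (g : T -> R) : Prop :=
  [/\ measurable_fun setT g,
      Pr.-integrable setT (fun w => (g (Y w))%:E) &
      forall B : set T, measurable B ->
        (\int[Pr]_(w in Y @^-1` B) (g (Y w))%:E =
         \int[Pr]_(w in Y @^-1` B) (X w)%:E)%E].

Definition has_density d (T : measurableType d) (R : realType)
    (eta nu : {measure set T -> \bar R}) (p : T -> R) : Prop :=
  [/\ measurable_fun setT p,
      forall x, 0 <= p x &
      forall B, measurable B -> (eta B = \int[nu]_(x in B) (p x)%:E)%E].

(* The integral of [(d eta_t^{1/2} - d eta_0^{1/2}) / t - b d eta_0^{1/2} / 2]^2
   is written with densities p t, p0 t of eta_t, eta_0 with respect to a measure
   nu t dominating both; its value does not depend on the choice of nu t. *)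
Definition has_score d (T : measurableType d) (R : realType)
    (path : R -> probability T R) (b : T -> R) : Prop :=
  b \in Lfun (path 0) 2%:E /\
  exists (nu : R -> {measure set T -> \bar R}) (p p0 : R -> T -> R),
    (forall t, has_density (path t) (nu t) (p t) /\
               has_density (path 0) (nu t) (p0 t)) /\
    (\int[nu t]_x
       (((Num.sqrt (p t x) - Num.sqrt (p0 t x)) / t
         - 2^-1 * b x * Num.sqrt (p0 t x)) ^+ 2)%:E)%E @[t --> 0^'+] --> 0%E.

Definition score_at d (T : measurableType d) (R : realType)
    (H : set (probability T R)) (eta0 : probability T R) : set (T -> R) :=
  [set b | exists (eps : R) (path : R -> probability T R),
     [/\ 0 < eps, path 0 = eta0,
         forall t, 0 <= t < eps -> H (path t) &
         has_score path b]].

Definition tangent_space d (T : measurableType d) (R : realType)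
    (H : set (probability T R)) (eta0 : probability T R) : set (T -> R) :=
  lin_span (score_at H eta0).

Definition nonparametric d (T : measurableType d) (R : realType)
    (H : set (probability T R)) (eta0 : probability T R) : Prop :=
  dense_in_L20 eta0 (tangent_space H eta0).

(* The density of Z when alpha has distribution eta; f a z is the conditional
   density of Z at z given alpha = a. *)
Definition mixture_density d1 d2 (T : measurableType d1)
    (TZ : measurableType d2) (R : realType) (A : set T) (f : T -> TZ -> R)
    (eta : probability T R) (z : TZ) : \bar R :=
  (\int[eta]_(a in A) (f a z)%:E)%E.

Definition moment d (T : measurableType d) (R : realType) (r : T -> R)
    (eta : probability T R) : R := fine ('E_eta[r])%E.

Definition bound_ratio (R : realType) (c v : R) : \bar R :=
  if v == 0 then (if c == 0 then 0%E else +oo%E) else (c / v)%:E.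

(* Ab ranges over the versions of E[b(alpha) | Z], all of which give the same
   ratio. *)
Definition efficiency_bound d0 d1 d2 (Omega : measurableType d0)
    (T : measurableType d1) (TZ : measurableType d2) (R : realType)
    (Pr : probability Omega R) (alpha : {mfun Omega >-> T})
    (Z : {mfun Omega >-> TZ}) (H : set (probability T R))
    (eta0 : probability T R) (r : T -> R) : \bar R :=
  ereal_sup [set x | exists (b : T -> R) (Ab : TZ -> R),
    [/\ tangent_space H eta0 b,
        is_cond_exp Pr (b \o alpha) Z Ab &
        x = bound_ratio
              (fine ('E_eta0[(fun a => (r a - moment r eta0) * b a)%R])%E ^+ 2)
              (fine ('E_Pr[(fun w => Ab (Z w) ^+ 2)%R])%E)]].

Definition identified d1 d2 (T : measurableType d1)
    (TZ : measurableType d2) (R : realType)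
    (mu : {measure set TZ -> \bar R}) (A : set T) (f : T -> TZ -> R)
    (H : set (probability T R)) (eta0 : probability T R) (r : T -> R) : Prop :=
  forall eta, H eta ->
    {ae mu, forall z,
       mixture_density A f eta z = mixture_density A f eta0 z} ->
    moment r eta = moment r eta0.

Definition regularly_identified d0 d1 d2 (Omega : measurableType d0)
    (T : measurableType d1) (TZ : measurableType d2) (R : realType)
    (mu : {measure set TZ -> \bar R}) (A : set T) (f : T -> TZ -> R)
    (Pr : probability Omega R) (alpha : {mfun Omega >-> T})
    (Z : {mfun Omega >-> TZ}) (H : set (probability T R))
    (eta0 : probability T R) (r : T -> R) : Prop :=
  identified mu A f H eta0 r /\
  (efficiency_bound Pr alpha Z H eta0 r < +oo)%E.

Definition cdf_at (R : realType) (n : nat) (ar : 'rV[R]_n) : borel_rV R n -> R :=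
  fun a : 'rV[R]_n => [forall i, a ord0 i <= ar ord0 i]%:R.

(* Main.v *)
(* If the efficiency bound is finite, the linear map A b |-> E[r_phi b] is bounded
   for the L2(P) norm on the image of the tangent space, so by Riesz it is
   represented by some s in L2(P).  Density of the tangent space upgrades this to
   r(alpha) - phi = E[s(Z) | alpha] = \int s f_{z/alpha} dmu almost surely, after
   centring s.  By dominated convergence the right-hand side is continuous at
   alpha_r.  But N lies in the support of eta0, so the left-hand side takes both
   values 1 - phi and - phi at points arbitrarily close to alpha_r where the
   identity holds: a contradiction. *)
Require Import Defs.
From HB Require Import structures.
From mathcomp Require Import all_boot all_order all_algebra.
From mathcomp Require Import all_classical all_reals all_analysis.
From mathcomp Require Import measurable_realfun ring lra.
Set Implicit Arguments.
Unset Strict Implicit.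
Unset Printing Implicit Defensive.
Import Order.TTheory GRing.Theory Num.Theory.
Import numFieldNormedType.Exports.
Local Open Scope classical_set_scope.
Local Open Scope ring_scope.

(** Riesz is used twice: to construct E[b(alpha) | Z], and to represent A b |-> E[r_phi b]. In the
    second use the domain is only the image of the tangent space, which need not be closed, and
    distinct scores may share the same A b. So the functional is given as a graph, and its
    representer is built as the L2 limit of approximate minimizers of |v|^2 - 2c, using nothing
    beyond c^2 <= M |v|^2. Two obstacles shape the end. The identity r - phi = \int s f dmu holds
    only eta0-a.e., so it says nothing at [alpha_r] or along a prescribed sequence; the approach
    sequences are therefore selected inside open sets, which near support points must meet every set
    of full measure. And the supremum of f over a neighbourhood may fail to be measurable, so it
    cannot itself serve as the dominating function. *)

(** * The L2 pairing and Cauchy-Schwarz *)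

(** Evaluate at the vertex [t = - b / c]; if [c = 0] the polynomial is affine and would reach -1
    unless [b = 0]. Serves both Cauchy-Schwarz and the first-order condition in the Riesz
    argument. *)
Lemma quad_discr (R : realFieldType) (a b c : R) : 0 <= a -> 0 <= c ->
  (forall t, 0 <= a + 2 * t * b + t ^+ 2 * c) -> b ^+ 2 <= a * c.
Proof.
move=> a0 c0 q.
have [c_gt0|] := ltP 0 c.
  have := q (- (b / c)).
  rewrite (_ : _ + _ = a - b ^+ 2 / c); last by field; rewrite gt_eqF.
  by rewrite subr_ge0 ler_pdivrMr.
move=> c_le0; have {c0 c_le0} c_eq0 : c = 0 by apply/eqP; rewrite eq_le c_le0 c0.
subst c; rewrite mulr0.
have [->|b0] := eqVneq b 0; first by rewrite expr0n.
have := q (- (a + 1) / (2 * b)).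
rewrite (_ : _ + _ = - 1); last by field.
by rewrite oppr_ge0 ler10.
Qed.

Section Lfun2.
Context d (T : measurableType d) (R : realType).
Variable mu : {measure set T -> \bar R}.
Local Notation L2 := (Lfun mu 2%:E).
Local Notation ip f g := (\int[mu]_x (f x * g x)).

Lemma Lfun_measurable (p : \bar R) (f : T -> R) :
  f \in Lfun mu p -> measurable_fun setT f.
Proof. by rewrite inE => /andP[/[!inE]]. Qed.

Lemma Lfun2P (f : T -> R) : f \in L2 <->
  measurable_fun setT f /\ mu.-integrable setT (EFin \o (fun x => f x ^+ 2)).
Proof.
split=> [lf|[mf f2]].
  by split; [exact: Lfun_measurable lf|exact: Lfun2_integrable_sqr].
apply/andP; split; rewrite inE//= /finite_norm unlock.
rewrite poweR_lty//.
have /integrableP[_] := f2; apply: le_lt_trans.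
apply: ge0_le_integral => //=.

- apply/measurable_EFinP.
  apply: (@measurableT_comp _ _ _ _ _ _ (fun x : R => x `^ 2)%R) => //.
  exact: measurableT_comp.
- apply/measurable_EFinP; apply: measurableT_comp => //.
  exact: measurable_funX.
- by move=> x _; rewrite lee_fin powR_mulrn// normrX.
Qed.

Lemma Lfun2_lin (f g : T -> R) (a : R) : f \in L2 -> g \in L2 ->
  (fun x => f x + a * g x) \in L2.
Proof.
move=> f2 g2.
have -> : (fun x => f x + a * g x) = f + a *: g by apply/funext => x.
by rewrite addrC; apply: (Lfun_submod_closed mu _).2 => //; rewrite lee1n.
Qed.

Lemma Lfun2B (f g : T -> R) : f \in L2 -> g \in L2 -> (fun x => f x - g x) \in L2.
Proof.
move=> f2 g2; have := Lfun2_lin (- 1) f2 g2.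
by under eq_fun do rewrite mulN1r.
Qed.

Lemma Lfun2Z (f : T -> R) (a : R) : f \in L2 -> (fun x => a * f x) \in L2.
Proof.
move=> f2; have := @Lfun_scale _ _ _ mu f a 2 _ f2.
by rewrite ler1n => /(_ isT); under eq_fun do rewrite mulrC.
Qed.

Lemma Lfun2_integrable_mul (f g : T -> R) : f \in L2 -> g \in L2 ->
  mu.-integrable setT (EFin \o (fun x => f x * g x)).
Proof. by move=> f2 g2; apply/Lfun1_integrable; exact: Lfun2_mul_Lfun1. Qed.

Lemma ipC (f g : T -> R) : ip f g = ip g f.
Proof. by apply: eq_Rintegral => x _; rewrite mulrC. Qed.

Lemma ip_ge0 (f : T -> R) : 0 <= ip f f.
Proof. by apply: Rintegral_ge0 => x _; rewrite -expr2 sqr_ge0. Qed.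

Lemma ip_linl (f g h : T -> R) (a : R) : f \in L2 -> g \in L2 -> h \in L2 ->
  ip (fun x => f x + a * g x) h = ip f h + a * ip g h.
Proof.
move=> f2 g2 h2.
rewrite -RintegralZl//; last exact: Lfun2_integrable_mul.
rewrite -RintegralD//; last 2 first.
- exact: Lfun2_integrable_mul.
- have -> : EFin \o (fun x => a * (g x * h x)) =
    EFin \o (fun x => (a * g x) * h x).
    by apply/funext => x /=; rewrite mulrA.
  by apply: Lfun2_integrable_mul => //; exact: Lfun2Z.
by apply: eq_Rintegral => x _; rewrite mulrDl mulrA.
Qed.

Lemma ipBl (f g h : T -> R) : f \in L2 -> g \in L2 -> h \in L2 ->
  ip (fun x => f x - g x) h = ip f h - ip g h.
Proof.
move=> f2 g2 h2; rewrite -mulN1r -ip_linl//.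
by apply: eq_Rintegral => x _; rewrite mulN1r.
Qed.

Lemma ip_sqr_lin (f g : T -> R) (a : R) : f \in L2 -> g \in L2 ->
  ip (fun x => f x + a * g x) (fun x => f x + a * g x) =
  ip f f + 2 * a * ip f g + a ^+ 2 * ip g g.
Proof.
move=> f2 g2; have h2 := Lfun2_lin a f2 g2.
rewrite ip_linl// (ipC f) (ipC g) !ip_linl// (ipC g f).
by ring.
Qed.

Lemma cauchy_schwarz (f g : T -> R) : f \in L2 -> g \in L2 ->
  ip f g ^+ 2 <= ip f f * ip g g.
Proof.
move=> f2 g2; apply: quad_discr; [exact: ip_ge0..|].
by move=> t; rewrite -ip_sqr_lin//; exact: ip_ge0.
Qed.

Lemma Lnorm2_lt_ip (f : T -> R) (e : R) : f \in L2 ->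
  ('N[mu]_2%:E[EFin \o f] < e%:E)%E -> ip f f < e ^+ 2.
Proof.
move=> f2 fe.
have N0 : (0 <= 'N[mu]_2%:E[EFin \o f])%E by exact: Lnorm_ge0.
have e0 : 0 < e by rewrite -lte_fin (le_lt_trans N0).
have Nfin : 'N[mu]_2%:E[EFin \o f]%E \is a fin_num.
  by rewrite ge0_fin_numE// (lt_le_trans fe) ?leey.
have := @powR_Lnorm _ _ _ mu (EFin \o f) 2 ltac:(by rewrite pnatr_eq0).
move: N0 fe Nfin; set N := Lnorm _ _ _ => N0 fe Nfin.
rewrite -(fineK Nfin) poweR_EFin powR_mulrn ?fine_ge0// => NE.
have -> : ip f f = fine N ^+ 2.
  rewrite -[RHS]/(fine (fine N ^+ 2)%:E) NE; congr fine.
  apply: eq_integral => x _.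
  by rewrite -expr2 poweR_EFin powR_mulrn// -normrX ger0_norm ?sqr_ge0.
have Ne : fine N < e by rewrite -lte_fin fineK.
by rewrite ltr_pXn2r// nnegrE ?fine_ge0// ltW.
Qed.

End Lfun2.

(** * Completeness of L2 along fast Cauchy sequences *)

Section completeness.
Context d (T : measurableType d) (R : realType).
Variable P : probability T R.
Local Notation L2 := (Lfun P 2%:E).
Local Notation ip f g := (\int[P]_x (f x * g x)).

Lemma EFin_ip (f : T -> R) : f \in L2 ->
  (\int[P]_x (f x ^+ 2)%:E)%E = (ip f f)%:E.
Proof.
move=> f2; rewrite /Rintegral fineK.
  by apply: eq_integral => x _; rewrite expr2.
have := integrable_fin_num measurableT (Lfun2_integrable_mul f2 f2).
exact.
Qed.

(** Cauchy-Schwarz against the constant 1, whose square has integral 1 under a probability. *)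
Lemma Lfun1_le_ip (f : T -> R) : f \in L2 ->
  (\int[P]_x `|f x|%:E <= (Num.sqrt (ip f f))%:E)%E.
Proof.
move=> f2.
have mf := Lfun_measurable f2.
have af2 : (fun x => `|f x|) \in L2.
  apply/Lfun2P; split; first exact: measurableT_comp.
  have /Lfun2P[_] := f2; congr (integrable _ _ _).
  by apply/funext => x /=; rewrite real_normK// num_real.
have c2 : cst 1 \in L2 by exact: Lfun_cst.
have := cauchy_schwarz af2 c2.
have -> : \int[P]_x (`|f x| * `|f x|) = ip f f.
  by apply: eq_Rintegral => x _; rewrite -normrM ger0_norm// -expr2 sqr_ge0.
have -> : \int[P]_x (cst 1 x * cst 1 x) = 1 :> R.
  under eq_Rintegral do rewrite /= mulr1.
  rewrite Rintegral_cst// mul1r; exact: (congr1 fine (probability_setT P)).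
rewrite mulr1.
have -> : \int[P]_x (`|f x| * cst 1 x) = \int[P]_x `|f x|.
  by apply: eq_Rintegral => x _; rewrite mulr1.
move=> h.
have i1 : (\int[P]_x `|f x|%:E)%E \is a fin_num.
  have := integrable_fin_num measurableT (Lfun2_integrable_mul af2 c2).
  by under eq_integral do rewrite /= mulr1.
have n0 : 0 <= \int[P]_x `|f x| by exact: Rintegral_ge0.
rewrite -[leLHS]fineK// lee_fin.
by rewrite -[leLHS](ger0_norm n0) -sqrtr_sqr ler_sqrt ?ip_ge0.
Qed.

(** Riesz-Fischer with a rate: the increments are summable in L1, so the sequence converges almost
    everywhere, and Fatou carries the distance bounds over to the limit. *)
Lemma Lfun2_complete (v : nat -> T -> R) :
  (forall n, v n \in L2) ->
  (forall m n, (m <= n)%N ->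
    ip (fun x => v m x - v n x) (fun x => v m x - v n x) <= 4^-1 ^+ m) ->
  exists2 s, s \in L2 &
    forall m, ip (fun x => v m x - s x) (fun x => v m x - s x) <= 4^-1 ^+ m.
Proof.
move=> v2 vC.
pose dif n x : R := `|v n.+1 x - v n x|.
have dif_ge0 n x : (0 <= (dif n x)%:E)%E by rewrite lee_fin normr_ge0.
have mv n : measurable_fun setT (v n) by exact: Lfun_measurable (v2 n).
have mdif n : measurable_fun setT (dif n).
  by apply: measurableT_comp => //; exact: measurable_funB.
(* The hypothesis bounds squared distances by 4^-n; the square root gives the summable bound
   2^-n. *)
have dif_int n : (\int[P]_x (dif n x)%:E <= (2^-1 ^+ n)%:E)%E.
  apply: le_trans (Lfun1_le_ip (Lfun2B (v2 n.+1) (v2 n))) _.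
  rewrite lee_fin -[leRHS]ger0_norm ?exprn_ge0// -sqrtr_sqr ler_sqrt ?sqr_ge0//.
  rewrite -exprM mulnC exprM [2^-1 ^+ 2](_ : _ = 4^-1); last by field.
  apply: le_trans (vC n n.+1 _) => //.
  rewrite le_eqVlt; apply/orP; left; apply/eqP.
  by apply: eq_Rintegral => x _; ring.
have sum_int : (\int[P]_x (\sum_(n <oo) (dif n x)%:E) < +oo)%E.
  rewrite integral_nneseries//; last by move=> n; exact/measurable_EFinP.
  apply: (@le_lt_trans _ _ (\sum_(n <oo) (2^-1 ^+ n)%:E)%E).
    apply: lee_nneseries => [n _ _|n _]; last exact: dif_int.
    by apply: integral_ge0.
  apply: (@le_lt_trans _ _ 2%:E); last exact: ltry.
  apply: lime_le.
    by apply: is_cvg_nneseries => n _ _; rewrite lee_fin exprn_ge0.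
  apply: nearW => n; rewrite sumEFin lee_fin.
  have /= := @geometric_le_lim R n 1 2^-1 ltac:(by []) ltac:(by rewrite invr_gt0).
  rewrite [_ - _](_ : _ = 2^-1); last by field.
  rewrite invrK mul1r ger0_norm// invf_lt1// ltr1n => /(_ isT).
  by rewrite /series/=; under eq_bigr do rewrite mul1r.
have cvgv : {ae P, forall x, cvgn (v ^~ x)}.
    have sum_i : P.-integrable setT (fun x => (\sum_(n <oo) (dif n x)%:E)%E).
    apply/integrableP; split.
      apply: ge0_emeasurable_sum => n //.
      by move=> _; exact/measurable_EFinP.
    under eq_integral do rewrite gee0_abs ?nneseries_ge0//.
    by [].
  apply: filterS (integrable_ae measurableT sum_i) => x /(_ I).
  rewrite ge0_fin_numE ?nneseries_ge0// => h.
  have : cvgn (series (telescope (v ^~ x))).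
    by apply: normed_cvg; apply: nnseries_is_cvg h => n; exact: normr_ge0.
  rewrite telescopeK => hx.
  have -> : v ^~ x = [sequence v n x - v 0%N x]_n \+ cst (v 0%N x).
    by apply/funext => n /=; rewrite subrK.
  by apply: is_cvgD => //; exact: is_cvg_cst.
(* The upper limit is measurable everywhere; [fine] alters it only where it is infinite, hence
   inside the null set where [v] does not converge. *)
pose s x := fine (limn_esup (fun n => (v n x)%:E)).
have ms : measurable_fun setT s.
  apply: measurableT_comp => //.
  by apply: measurable_fun_limn_esup => n; exact/measurable_EFinP.
have vs : {ae P, forall x, v ^~ x @ \oo --> s x}.
  apply: filterS cvgv => x cx.
  rewrite /s is_cvg_limn_esupE.
    by rewrite EFin_lim//; exact: cx.
  by apply/cvg_ex; exists (limn (v ^~ x))%:E; apply: cvg_EFin => //; exact: nearW.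
have key m : (\int[P]_x ((v m x - s x) ^+ 2)%:E <= (4^-1 ^+ m)%:E)%E.
  pose g n x : \bar R := ((v m x - v n x) ^+ 2)%:E.
  have mg n : measurable_fun setT (g n).
    by apply/measurable_EFinP/measurable_funX; exact: measurable_funB.
  rewrite (@ae_eq_integral _ _ _ P setT (fun x => limn_einf (g ^~ x)))//.
  - apply: le_trans (fatou P measurableT mg _) _.
      by move=> n x _; rewrite lee_fin sqr_ge0.
    rewrite limn_einf_lim; apply: lime_le; first exact: is_cvg_einfs.
    apply: nearW => k; apply: ge_ereal_inf.
    (* The index must lie in the tail from [k] on and also be at least [m], so that [vC] applies. *)
    exists (\int[P]_x g (maxn k m) x)%E.
      by exists (maxn k m) => //=; rewrite leq_maxl.
    rewrite EFin_ip ?lee_fin; last exact: Lfun2B.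
    by apply: vC; rewrite leq_maxr.
  - by apply/measurable_EFinP/measurable_funX; exact: measurable_funB.
  - under eq_fun do rewrite -(oppeK (limn_einf _)) -limn_esupN.
    apply: measurableT_comp => //.
    by apply: measurable_fun_limn_esup => n; exact: measurableT_comp.
  - apply: filterS vs => x vx _.
    have : g ^~ x @ \oo --> ((v m x - s x) ^+ 2)%:E.
      apply: cvg_EFin; first exact: nearW.
      rewrite /comp /=; apply: cvgM; apply: cvgB => //; exact: cvg_cst.
    move=> gx; rewrite is_cvg_limn_einfE; first by rewrite (cvg_lim _ gx).
    by apply/cvg_ex; eexists; exact: gx.
have dL2 m : (fun x => v m x - s x) \in L2.
  apply/Lfun2P; split; first exact: measurable_funB.
  apply/integrableP; split.
    by apply/measurable_EFinP/measurable_funX; exact: measurable_funB.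
  apply: le_lt_trans (ltry (4^-1 ^+ m)); apply: le_trans (key m).
  by under eq_integral do rewrite /= ger0_norm ?sqr_ge0//.
exists s.
  have := Lfun2B (v2 0%N) (dL2 0%N).
  by under eq_fun do rewrite opprB addrC subrK.
by move=> m; rewrite -lee_fin -EFin_ip.
Qed.

End completeness.

Lemma le0_of_le_geometric (R : realType) (K y : R) :
  (forall m, y <= K * 4^-1 ^+ m) -> y <= 0.
Proof.
move=> yK.
have h : geometric K (4^-1 : R) @ \oo --> 0.
  by apply: cvg_geometric; rewrite ger0_norm// invf_lt1// ltr1n.
rewrite -(cvg_lim _ h)//; apply: limr_ge; first by apply/cvg_ex; exists 0.
by apply: nearW => m; exact: yK.
Qed.

(** * Riesz representation on a subspace that need not be closed *)

Section riesz.
Context d (T : measurableType d) (R : realType).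
Variable P : probability T R.
Local Notation L2 := (Lfun P 2%:E).
Local Notation ip f g := (\int[P]_x (f x * g x)).

(* S is the graph of the functional; on a graph, boundedness already yields
   well-definedness. *)
Lemma riesz_graph (S : (T -> R) -> R -> Prop) (M : R) : 0 <= M ->
  (exists v c, S v c) ->
  (forall v w c e a, S v c -> S w e ->
     S (fun x => v x + a * w x) (c + a * e)) ->
  (forall v c, S v c -> v \in L2) ->
  (forall v c, S v c -> c ^+ 2 <= M * ip v v) ->
  exists2 s, s \in L2 & forall v c, S v c -> c = ip s v.
Proof.
move=> M0 [v0 [c0 S0]] Slin SL2 Sbnd.
(* If [s] represents the functional, then |v|^2 - 2c = |v - s|^2 - |s|^2, so minimizing sequences
   converge to the projection of [s] on the closure of the subspace. *)
pose E := [set y | exists v c, S v c /\ y = ip v v - 2 * c].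
have infE : has_inf E.
  split; first by exists (ip v0 v0 - 2 * c0), v0, c0.
  exists (- M) => _ [v [c [Svc ->]]].
  have := Sbnd _ _ Svc; have := ip_ge0 P v; set q := ip v v => q0 cq.
  rewrite leNgt; apply/negP => lt_q.
  (* A value below - M means 2c > M + q, whereas 4 c^2 <= 4 M q <= (M + q)^2. *)
  have : (M + q) ^+ 2 < (2 * c) ^+ 2.
    by rewrite ltr_pXn2r// ?nnegrE; lra.
  by have := sqr_ge0 (M - q); nra.
pose J0 := inf E; pose e_ m : R := 4^-1 ^+ m / 4.
have e_gt0 m : 0 < e_ m by rewrite divr_gt0// exprn_gt0// invr_gt0.
have /choice[vc Svc] : forall m, exists p : (T -> R) * R,
    S p.1 p.2 /\ ip p.1 p.1 - 2 * p.2 < J0 + e_ m.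
  move=> m; have [_ [v [c [Svc ->]]] lt_J] := inf_adherent (e_gt0 m) infE.
  by exists (v, c).
(* First-order condition at an approximate minimizer. *)
have foc m w a : S w a ->
    (ip (vc m).1 w - a) ^+ 2 <= e_ m * ip w w.
  move=> Sw; have [Sm lt_J] := Svc m.
  apply: quad_discr; [exact: ltW|exact: ip_ge0|] => t.
  have : J0 <= ip (vc m).1 (vc m).1 - 2 * (vc m).2 + 2 * t * (ip (vc m).1 w - a)
     + t ^+ 2 * ip w w.
    apply: (inf_lbound infE.2).
    exists (fun x => (vc m).1 x + t * w x), ((vc m).2 + t * a); split.
      exact: Slin.
    by rewrite ip_sqr_lin ?(SL2 _ _ Sm) ?(SL2 _ _ Sw)//; ring.
  by move: lt_J; lra.
have v2 m : (vc m).1 \in L2 by exact: SL2 (Svc m).1.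
(* With w = v_m - v_n and a = c_m - c_n, |w|^2 is the difference of the two first-order errors <v_m,
   w> - a and <v_n, w> - a. Hence |w|^4 <= 4 e_m |w|^2, and the division by 4 in [e_] turns this
   into the rate 4^-m. *)
have [s s2 vs] : exists2 s, s \in L2 & forall m,
    ip (fun x => (vc m).1 x - s x) (fun x => (vc m).1 x - s x) <= 4^-1 ^+ m.
  apply: (Lfun2_complete (v := fun m => (vc m).1)) => // m n mn.
  pose w x := (vc m).1 x - (vc n).1 x.
  change (ip w w <= 4^-1 ^+ m).
  have Sw : S w ((vc m).2 - (vc n).2).
    have := Slin _ _ _ _ (- 1) (Svc m).1 (Svc n).1.
    by under eq_fun do rewrite mulN1r; rewrite mulN1r.
  have := foc m _ _ Sw; have := foc n _ _ Sw.
  have : ip w w = ip (vc m).1 w - ip (vc n).1 w.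
    by rewrite ipBl ?(SL2 _ _ Sw).
  have : e_ n <= e_ m.
    by rewrite ler_pM2r// ler_wiXn2l// ?invr_ge0// invf_le1 ?ler1n.
  have -> : 4^-1 ^+ m = 4 * e_ m by rewrite mulrC divfK.
  have := e_gt0 m; have := ip_ge0 P w.
  move: (ip w w) (ip (vc m).1 w) (ip (vc n).1 w) ((vc m).2 - (vc n).2).
  move=> q x y a.
  move=> q0 em en qE yh xh.
  have [q_le|q_gt] := leP q (4 * e_ m) => //.
  have : e_ n * q <= e_ m * q by rewrite ler_wpM2r.
  have : 0 <= ((x - a) + (y - a)) ^+ 2 by exact: sqr_ge0.
  have : 4 * e_ m * q < q * q by rewrite ltr_pM2r//; lra.
  have : q * q = (x - y) ^+ 2 by rewrite -qE expr2.
  by nra.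
exists s => // w a Sw.
have w2 := SL2 _ _ Sw.
(* <s, w> - a is compared with <v_m, w>: one error is controlled by |v_m - s|, the other by [foc],
   and (x - y)^2 <= 2 x^2 + 2 y^2 yields the factor 4. *)
apply/eqP; rewrite eq_sym -subr_eq0 -sqrf_eq0 eq_le sqr_ge0 andbT.
apply: (@le0_of_le_geometric _ (4 * ip w w)) => m.
have := foc m _ _ Sw.
have := cauchy_schwarz (Lfun2B (v2 m) s2) w2; rewrite ipBl//.
have := vs m; set u := (X in X <= _) => um.
have : u * ip w w <= 4^-1 ^+ m * ip w w by rewrite ler_wpM2r// ip_ge0.
have : e_ m * ip w w <= 4^-1 ^+ m * ip w w.
  rewrite ler_wpM2r ?ip_ge0// /e_ ler_pdivrMr//.
  have : 0 <= 4^-1 ^+ m :> R by rewrite exprn_ge0// invr_ge0.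
  by lra.
move: (ip w w) (u * _) (ip s w) (ip (vc m).1 w) => q uq sw vw.
have := sqr_ge0 ((vw - sw) + (vw - a)).
by nra.
Qed.
End riesz.

(** * Change of variables under the law of a random element *)

Section law.
Context d d' (Omega : measurableType d) (T : measurableType d') (R : realType).
Variables (Pr : probability Omega R) (X : {mfun Omega >-> T}).
Variable nu : probability T R.
Hypothesis nuX : nu = distribution Pr X :> (set T -> \bar R).

Lemma ge0_integral_law (h : T -> \bar R) : measurable_fun setT h ->
  (forall y, 0 <= h y)%E -> (\int[nu]_y h y = \int[Pr]_w h (X w))%E.
Proof.
move=> mh h0; rewrite -(@ge0_integral_distribution _ _ _ _ _ Pr X h)//.
by apply: eq_measure_integral => B _ _; exact: (congr1 (@^~ B) nuX).
Qed.

Lemma integrable_law (h : T -> \bar R) : nu.-integrable setT h ->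
  Pr.-integrable setT (h \o X).
Proof.
move=> /integrableP[mh ih]; apply/integrableP; split.
  exact: measurableT_comp.
rewrite (le_lt_trans _ ih)// (@ge0_integral_law (fun y => `|h y|%E))//.
exact: measurableT_comp.
Qed.

Lemma integral_law (h : T -> \bar R) : nu.-integrable setT h ->
  (\int[nu]_y h y = \int[Pr]_w h (X w))%E.
Proof.
move=> ih; have mh := measurable_int _ ih.
rewrite -[RHS](@integral_distribution _ _ _ _ _ Pr X h)//; last first.
  exact: integrable_law.
by apply: eq_measure_integral => B _ _; exact: (congr1 (@^~ B) nuX).
Qed.

Lemma Rintegral_law (h : T -> R) : nu.-integrable setT (EFin \o h) ->
  \int[nu]_y h y = \int[Pr]_w h (X w).
Proof. by move=> ih; rewrite /Rintegral integral_law. Qed.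

Lemma Lfun2_law (h : T -> R) : h \in Lfun nu 2%:E -> h \o X \in Lfun Pr 2%:E.
Proof.
move=> /Lfun2P[mh h2]; apply/Lfun2P; split; first exact: measurableT_comp.
exact: integrable_law h2.
Qed.

End law.

Lemma Lfun_indic d (T : measurableType d) (R : realType) (P : probability T R)
  (B : set T) : measurable B -> (\1_B : T -> R) \in Lfun P 2%:E.
Proof.
move=> mB; apply/Lfun2P; split; first exact: measurable_indic.
rewrite (_ : _ \o _ = EFin \o \1_B); first exact: integrable_indic.
by apply/funext => x /=; rewrite indicE; case: (_ \in _); rewrite ?expr1n ?expr0n.
Qed.

(** * Conditional expectation in L2, by duality *)

Section conditional_expectation.
Context d d' (Omega : measurableType d) (T : measurableType d') (R : realType).
Variables (Pr : probability Omega R) (Z : {mfun Omega >-> T}).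
Variable P : probability T R.
Hypothesis PZ : P = distribution Pr Z :> (set T -> \bar R).

(** Testing against all L2 functions of Z is the form that Riesz delivers; it is linear in [X], and
    one may test with the representer itself. *)
Definition L2_cond_exp (X : Omega -> R) (g : T -> R) :=
  g \in Lfun P 2%:E /\
  forall k, k \in Lfun P 2%:E ->
    \int[P]_z (g z * k z) = \int[Pr]_w (X w * k (Z w)).

(** Riesz for k |-> E[k(Z) X], which Cauchy-Schwarz bounds with M = E[X^2]. *)
Lemma L2_cond_exp_exists (X : Omega -> R) : X \in Lfun Pr 2%:E ->
  exists g, L2_cond_exp X g.
Proof.
move=> X2.
pose S (k : T -> R) c := k \in Lfun P 2%:E /\ c = \int[Pr]_w (k (Z w) * X w).
have [||||g g2 gS] := @riesz_graph _ _ _ P S (\int[Pr]_w (X w * X w)) (ip_ge0 _ _).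
- by exists (cst 0), (\int[Pr]_w (cst 0 (Z w) * X w)); split => //; exact: Lfun_cst.
- move=> v w c e a [v2 ->] [w2 ->]; split; first exact: Lfun2_lin.
  have vZ := Lfun2_law PZ v2; have wZ := Lfun2_law PZ w2.
  by rewrite -(ip_linl a vZ wZ X2).
- by move=> v c [].
- move=> v c [v2 ->]; have vZ := Lfun2_law PZ v2.
  rewrite (Rintegral_law PZ (Lfun2_integrable_mul v2 v2)).
  by rewrite mulrC; exact: (cauchy_schwarz vZ X2).
exists g; split => // k k2; rewrite -(gS k (\int[Pr]_w (k (Z w) * X w)))//.
exact: ipC.
Qed.

(** Testing with indicators. This makes [g] an admissible [Ab] in [efficiency_bound]. *)
Lemma L2_cond_exp_is_cond_exp (X : Omega -> R) (g : T -> R) :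
  X \in Lfun Pr 2%:E -> L2_cond_exp X g -> is_cond_exp Pr X Z g.
Proof.
move=> X2 [g2 gE]; have gZ := Lfun2_law PZ g2.
have L2i h : h \in Lfun Pr 2%:E -> Pr.-integrable setT (EFin \o h).
  by move=> ?; apply/Lfun1_integrable/Lfun_subset12 => //; exact: fin_num_measure.
split; [exact: Lfun_measurable g2|exact: (L2i _ gZ)|].
move=> B mB; have B2 := @Lfun_indic _ _ _ P _ mB; have BZ := Lfun2_law PZ B2.
have key h : h \in Lfun Pr 2%:E ->
    (\int[Pr]_(w in Z @^-1` B) (h w)%:E = (\int[Pr]_w (h w * \1_B (Z w)))%:E)%E.
  move=> h2; rewrite /Rintegral fineK; last first.
    exact: (integrable_fin_num measurableT (Lfun2_integrable_mul h2 BZ)).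
  rewrite [LHS]integral_mkcond; apply: eq_integral => w _.
  rewrite patchE indicE/= (_ : (Z w \in B) = (w \in Z @^-1` B)) ?inE//.
  by case: ifP => _; rewrite ?mulr1 ?mulr0.
rewrite (key _ gZ) (key _ X2) -gE//.
by congr EFin; rewrite (Rintegral_law PZ (Lfun2_integrable_mul g2 B2)).
Qed.

Lemma L2_cond_exp_lin (X Y : Omega -> R) (g h : T -> R) (a : R) :
  X \in Lfun Pr 2%:E -> Y \in Lfun Pr 2%:E ->
  L2_cond_exp X g -> L2_cond_exp Y h ->
  L2_cond_exp (fun w => X w + a * Y w) (fun z => g z + a * h z).
Proof.
move=> X2 Y2 [g2 gE] [h2 hE]; split; first exact: Lfun2_lin.
move=> k k2; have kZ := Lfun2_law PZ k2.
rewrite ip_linl// gE// hE//.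
by rewrite (ip_linl (h := k \o Z)).
Qed.

End conditional_expectation.

(** * Integration against a mixture of densities *)

Section mixture.
Import HBNNSimple.
Context d d' (T : measurableType d) (TZ : measurableType d') (R : realType).
Variables (eta : {measure set T -> \bar R}).
Variable mu : {sigma_finite_measure set TZ -> \bar R}.
Variables (f : T * TZ -> R) (D : set T).
Hypothesis mf : measurable_fun setT f.
Hypothesis f0 : forall x, 0 <= f x.
Hypothesis mD : measurable D.

Let mfa a : measurable_fun setT (fun z => f (a, z)).
Proof. exact: measurableT_comp. Qed.

Lemma measurable_partial_integral (h : TZ -> R) : measurable_fun setT h ->
  (forall z, 0 <= h z) ->
  measurable_fun setT (fun a => \int[mu]_z (h z * f (a, z))%:E)%E.
Proof.
move=> mh h0.
apply: (@measurable_fun_fubini_tonelli_F _ _ _ _ _ mu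
  (fun x => (h x.2 * f x)%:E)) => [|x].
  apply/measurable_EFinP; apply: measurable_funM => //.
  exact: measurableT_comp.
by rewrite lee_fin mulr_ge0.
Qed.

Let integral_indicM (C : set TZ) a :
  (\int[mu]_(z in C) (f (a, z))%:E = \int[mu]_z (\1_C z * f (a, z))%:E)%E.
Proof.
rewrite integral_mkcond; apply: eq_integral => z _.
by rewrite patchE indicE; case: ifPn => _; rewrite ?mul1r ?mul0r.
Qed.

Variable m : {measure set TZ -> \bar R}.
Hypothesis mE : forall C, measurable C ->
  (m C = \int[eta]_(a in D) \int[mu]_(z in C) (f (a, z))%:E)%E.

Let integral_mixture_nnsfun (h : {nnsfun TZ >-> R}) :
  (\int[m]_z (h z)%:E = \int[eta]_(a in D) \int[mu]_z (h z * f (a, z))%:E)%E.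
Proof.
pose k r z : R := r * \1_(h @^-1` [set r]) z.
have k0 r z : 0 <= k r z by rewrite -lee_fin nnfun_muleindic_ge0.
have mk r : measurable_fun setT (k r) by exact: measurable_funM.
have hE z a : (h z * f (a, z))%:E = (\sum_(r \in range h) (k r z * f (a, z))%:E)%E.
  by rewrite fsumEFin// -mulr_fsuml -fimfunE.
rewrite integralT_nnsfun sintegralE.
transitivity (\sum_(r \in range h)
    \int[eta]_(a in D) \int[mu]_z (k r z * f (a, z))%:E)%E; last first.
  rewrite -ge0_integral_fsum//.
  - apply: eq_integral => a _; rewrite -ge0_integral_fsum//.
    + by apply: eq_integral => z _.
    + by move=> r; apply/measurable_EFinP/measurable_funM.
    + by move=> r z _; rewrite lee_fin mulr_ge0.
  - by move=> r; apply: measurable_funTS; exact: measurable_partial_integral.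
  - by move=> r a _; apply: integral_ge0 => z _; rewrite lee_fin mulr_ge0.
apply: eq_fsbigr => r /set_mem[z0 _ z0r].
have r0 : 0 <= r by rewrite -z0r.
have mC : measurable (h @^-1` [set r]) by [].
rewrite mE//; under eq_integral do rewrite integral_indicM.
rewrite -ge0_integralZl//; last 2 first.
- by apply: measurable_funTS; apply: measurable_partial_integral.
- by move=> a _; apply: integral_ge0 => z _; rewrite lee_fin mulr_ge0.
apply: eq_integral => a _; rewrite -ge0_integralZl//; last 2 first.
- by apply/measurable_EFinP/measurable_funM.
- by move=> z _; rewrite lee_fin mulr_ge0.
by apply: eq_integral => z _; rewrite -EFinM mulrA.
Qed.

(** Extension from simple functions by monotone convergence, applied under [m], under [eta], and
    inside under [mu]; [inner_nd] supplies the monotonicity for the [eta] integral. *)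
Lemma integral_mixture (h : TZ -> R) : measurable_fun setT h ->
  (forall z, 0 <= h z) ->
  (\int[m]_z (h z)%:E = \int[eta]_(a in D) \int[mu]_z (h z * f (a, z))%:E)%E.
Proof.
move=> mh h0; have mEh : measurable_fun setT (EFin \o h) by exact/measurable_EFinP.
pose h_ := nnsfun_approx measurableT mEh.
have h_h z : (EFin \o h_ ^~ z) @ \oo --> (h z)%:E.
  by apply: cvg_nnsfun_approx => // y _; rewrite lee_fin.
have h_nd z i j : (i <= j)%N -> h_ i z <= h_ j z.
  by move=> ij; exact/lefP/nd_nnsfun_approx.
transitivity (limn (fun n => \int[m]_z (h_ n z)%:E)%E).
  rewrite -monotone_convergence//.
  - by apply: eq_integral => z _; apply/esym/cvg_lim => //; exact: h_h.
  - by move=> n; exact/measurable_EFinP.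
  - by move=> n z _; rewrite lee_fin.
  - by move=> z _ i j ij; rewrite lee_fin h_nd.
under eq_fun do rewrite integral_mixture_nnsfun.
have inner_nd a : nondecreasing_seq
    (fun n => \int[mu]_z (h_ n z * f (a, z))%:E)%E.
  move=> i j ij; apply: ge0_le_integral => //.
  - by move=> z _; rewrite lee_fin mulr_ge0.
  - by apply/measurable_EFinP/measurable_funM.
  - by apply/measurable_EFinP/measurable_funM.
  - by move=> z _; rewrite lee_fin ler_wpM2r// h_nd.
rewrite -monotone_convergence//.
- apply: eq_integral => a _; rewrite -monotone_convergence//.
  + apply: eq_integral => z _; apply/cvg_lim => //.
    apply: cvg_EFin; first exact: nearW.
    rewrite /comp /=.
    by apply: cvgM; [exact: (fine_cvg (h_h z))|exact: cvg_cst].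
  + by move=> n; apply/measurable_EFinP/measurable_funM.
  + by move=> n z _; rewrite lee_fin mulr_ge0.
  + by move=> z _ i j ij; rewrite lee_fin ler_wpM2r// h_nd.
- by move=> n; apply: measurable_funTS; exact: measurable_partial_integral.
- by move=> n a _; apply: integral_ge0 => z _; rewrite lee_fin mulr_ge0.
Qed.

End mixture.

(** * Linear spans, the tangent space and centring *)

Lemma lin_span_lin (T : Type) (R : realType) (S : set (T -> R)) (b c : T -> R)
  (a : R) : lin_span S b -> lin_span S c -> lin_span S (fun x => b x + a * c x).
Proof.
move=> [n1 [c1 [v1 [S1 ->]]]] [n2 [c2 [v2 [S2 ->]]]].
exists (n1 + n2)%N,
  (fun i => match fintype.split i with inl j => c1 j | inr j => a * c2 j end),
  (fun i => match fintype.split i with inl j => v1 j | inr j => v2 j end); split.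
  by move=> i; case: splitP.
apply/funext => x; rewrite big_split_ord /= mulr_sumr; congr (_ + _).
  by apply: eq_bigr => i _; rewrite (unsplitK (inl i)).
by apply: eq_bigr => i _; rewrite (unsplitK (inr i)) mulrA.
Qed.

Lemma tangent_space_Lfun2 d (T : measurableType d) (R : realType)
  (H : set (probability T R)) (eta0 : probability T R) (b : T -> R) :
  tangent_space H eta0 b -> b \in Lfun eta0 2%:E.
Proof.
move=> [n [c [v [Sv ->]]]].
have v2 i : v i \in Lfun eta0 2%:E.
  by have [eps [path [_ p0 _ [+ _]]]] := Sv i; rewrite p0.
elim: n c v {Sv} v2 => [|n IH] c v v2.
  under eq_fun do rewrite big_ord0.
  exact: Lfun_cst.
under eq_fun do rewrite big_ord_recr /=.
by apply: Lfun2_lin => //; exact: IH.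
Qed.

Lemma Rintegral_indicM d (T : measurableType d) (R : realType)
  (mu : {measure set T -> \bar R}) (D : set T) (f : T -> R) :
  \int[mu]_(x in D) f x = \int[mu]_x (\1_D x * f x).
Proof.
rewrite Rintegral_mkcond; apply: eq_Rintegral => x _.
by rewrite patchE indicE; case: ifP => _; rewrite ?mul1r ?mul0r.
Qed.

Section centring.
Context d (T : measurableType d) (R : realType) (nu : probability T R).

Lemma Lfun2_Lfun1 (f : T -> R) : f \in Lfun nu 2%:E -> f \in Lfun nu 1.
Proof. by move=> ?; apply: Lfun_subset12 => //; exact: fin_num_measure. Qed.

Lemma Rintegral_moment (f : T -> R) : \int[nu]_x f x = moment f nu.
Proof. by rewrite /moment unlock. Qed.

Lemma L20_centred (f : T -> R) : f \in Lfun nu 2%:E ->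
  L20 nu (fun x => f x - moment f nu).
Proof.
move=> f2; have f1 := Lfun2_Lfun1 f2; split.
  by apply: Lfun2B => //; exact: Lfun_cst.
rewrite (@expectationB _ _ _ nu f (cst (moment f nu)))//; last exact: Lfun_cst.
by rewrite expectation_cst /moment fineK ?subee// expectation_fin_num.
Qed.

Lemma moment_indic (B : set T) : measurable B -> moment (\1_B) nu = fine (nu B).
Proof. by move=> mB; rewrite /moment expectation_indic. Qed.

End centring.

(** * From a finite efficiency bound to a representer s(Z) *)

Section representer.
Context d0 d1 d2 (Omega : measurableType d0) (T : measurableType d1)
  (TZ : measurableType d2) (R : realType) (Pr : probability Omega R).
Variables (alpha : {mfun Omega >-> T}) (Z : {mfun Omega >-> TZ}).
Variables (H : set (probability T R)) (eta0 : probability T R).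
Variables (P : probability TZ R) (r : T -> R).
Hypothesis alpha_law : eta0 = distribution Pr alpha :> (set T -> \bar R).
Hypothesis Z_law : P = distribution Pr Z :> (set TZ -> \bar R).
Hypothesis r2 : r \in Lfun eta0 2%:E.

Local Notation rphi := (fun a => r a - moment r eta0).

Let rphi2 : rphi \in Lfun eta0 2%:E.
Proof. by apply: Lfun2B => //; exact: Lfun_cst. Qed.

Lemma efficiency_bound_representer :
  (efficiency_bound Pr alpha Z H eta0 r < +oo)%E ->
  exists2 s, s \in Lfun P 2%:E & forall b, tangent_space H eta0 b ->
    \int[eta0]_a (rphi a * b a) = \int[Pr]_w (b (alpha w) * s (Z w)).
Proof.
move=> bound_lty.
have [M M0 bound_M] : exists2 M : R, 0 <= M &
    (efficiency_bound Pr alpha Z H eta0 r <= M%:E)%E.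
  move: bound_lty; case: (efficiency_bound _ _ _ _ _ _) => [x _| //|_].
    by exists (Num.max 0 x); rewrite ?lee_fin le_max lexx ?orbT.
  by exists 0; rewrite ?leNye.
(* The graph of A b |-> E[r_phi b]; that [c] depends on [k] alone is not known at this point and
   comes out of the bound. *)
pose S (k : TZ -> R) (c : R) := exists b, [/\ tangent_space H eta0 b,
  L2_cond_exp Pr Z P (b \o alpha) k & c = \int[eta0]_a (rphi a * b a)].
have Talpha b : tangent_space H eta0 b -> b \o alpha \in Lfun Pr 2%:E.
  by move=> Tb; apply: (Lfun2_law alpha_law); exact: tangent_space_Lfun2 Tb.
have exS b : tangent_space H eta0 b ->
    exists2 k, S k (\int[eta0]_a (rphi a * b a)) &
    L2_cond_exp Pr Z P (b \o alpha) k.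
  move=> Tb; have [k kb] := L2_cond_exp_exists Z_law (Talpha _ Tb).
    by exists k => //; exists b.
have [||||s s2 sS] := @riesz_graph _ _ _ P S M M0.
- have [k Sk _] : exists2 k, S k (\int[eta0]_a (rphi a * cst 0 a)) &
      L2_cond_exp Pr Z P (cst 0 \o alpha) k.
    apply: exS; exists 0%N, (fun=> 0), (fun=> cst 0); split; first by case.
    by apply/funext => x; rewrite big_ord0.
  by exists k, (\int[eta0]_a (rphi a * cst 0 a)).
- move=> k l c e a [b [Tb bk ->]] [b' [Tb' b'l ->]].
  exists (fun x => b x + a * b' x); split.
  + exact: lin_span_lin.
  + exact: (L2_cond_exp_lin Z_law a (Talpha _ Tb) (Talpha _ Tb') bk b'l).
  + have b2 := tangent_space_Lfun2 Tb; have b'2 := tangent_space_Lfun2 Tb'.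
    by rewrite !(ipC _ rphi) ip_linl.
- by move=> k c [b [_ []]].
- move=> k c [b [Tb bk ->]]; have [k2 _] := bk.
  have : (bound_ratio
    (fine ('E_eta0[(fun a => rphi a * b a)%R])%E ^+ 2)
    (fine ('E_Pr[(fun w => k (Z w) ^+ 2)%R])%E) <= M%:E)%E.
    apply: le_trans bound_M; apply: ereal_sup_ubound.
    exists b, k; split => //.
    exact: (L2_cond_exp_is_cond_exp Z_law (Talpha _ Tb)).
  rewrite unlock -!/(Rintegral _ _ _).
  have -> : \int[Pr]_w (k (Z w) ^+ 2) = \int[P]_z (k z * k z).
    rewrite (Rintegral_law Z_law (Lfun2_integrable_mul k2 k2)).
    by apply: eq_Rintegral => w _; rewrite expr2.
  (* When A b has zero norm, the convention c/0 = +oo together with the finite bound forces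
     E[r_phi b] = 0. *)
  rewrite /bound_ratio; case: eqVneq => [->|kk0].
    by case: eqVneq => [->|//]; rewrite mulr0.
  by rewrite lee_fin ler_pdivrMr// lt_neqAle eq_sym kk0 ip_ge0.
exists s => // b Tb; have [k Sk [_ kE]] := exS _ Tb.
by rewrite (sS _ _ Sk) ipC kE.
Qed.

Hypothesis np : nonparametric H eta0.

(** The difference of the two sides is linear in [g], vanishes on scores and is L2-continuous, so
    density makes it vanish. *)
Lemma representer_L20 (s : TZ -> R) : s \in Lfun P 2%:E ->
  (forall b, tangent_space H eta0 b ->
    \int[eta0]_a (rphi a * b a) = \int[Pr]_w (b (alpha w) * s (Z w))) ->
  forall g, L20 eta0 g ->
    \int[eta0]_a (rphi a * g a) = \int[Pr]_w (g (alpha w) * s (Z w)).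
Proof.
move=> s2 sT g Lg; have g2 := Lg.1.
have sZ2 := Lfun2_law Z_law s2.
apply/eqP; rewrite -subr_eq0 -sqrf_eq0 eq_le sqr_ge0 andbT.
(* With |g - b|^2 < 4^-m, Cauchy-Schwarz bounds each of the two terms, and (x - y)^2 <= 2 x^2 + 2
   y^2 gives the factor 2. *)
apply: (@le0_of_le_geometric _ (2 * (\int[eta0]_a (rphi a * rphi a) +
  \int[Pr]_w (s (Z w) * s (Z w))))) => m.
have e0 : 0 < 2^-1 ^+ m :> R by rewrite exprn_gt0// invr_gt0.
have [b Tb gb] := np Lg e0.
have b2 := tangent_space_Lfun2 Tb; have gb2 := Lfun2B g2 b2.
have := Lnorm2_lt_ip gb2 gb.
rewrite -exprM mulnC exprM [2^-1 ^+ 2](_ : _ = 4^-1); last by field.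
have -> : \int[eta0]_a (rphi a * g a) - \int[Pr]_w (g (alpha w) * s (Z w)) =
    \int[eta0]_a ((g a - b a) * rphi a) -
    \int[Pr]_w ((g (alpha w) - b (alpha w)) * s (Z w)).
  have /= -> := ipBl (Lfun2_law alpha_law g2) (Lfun2_law alpha_law b2) sZ2.
  have /= -> := ipBl g2 b2 rphi2.
  by rewrite (ipC eta0 g) (ipC eta0 b) (sT _ Tb); ring.
have gba2 := Lfun2_law alpha_law gb2.
have := cauchy_schwarz gb2 rphi2; have := cauchy_schwarz gba2 sZ2.
rewrite -(Rintegral_law alpha_law (Lfun2_integrable_mul gb2 gb2)) /=.
have := ip_ge0 eta0 rphi; have := ip_ge0 Pr (s \o Z) => /=.
set A := \int[Pr]_w (s _ * _); set B := \int[eta0]_a (rphi _ * _).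
set q := \int[eta0]_a ((g a - b a) * (g a - b a)).
move=> A0 B0; set x := \int[Pr]_w _; set y := \int[eta0]_a _ => xA yB q4.
have : q * A <= A * 4^-1 ^+ m by rewrite mulrC ler_wpM2l// ltW.
have : q * B <= B * 4^-1 ^+ m by rewrite mulrC ler_wpM2l// ltW.
by have := sqr_ge0 (x + y); nra.
Qed.

(* The score-orthogonality only determines s up to constants; centring it makes
   the identity hold for all indicators, not just for mean-zero functions. *)
Lemma centred_representer :
  (efficiency_bound Pr alpha Z H eta0 r < +oo)%E ->
  exists2 s, L20 P s & forall B, measurable B ->
    \int[eta0]_(a in B) rphi a = \int[Pr]_(w in alpha @^-1` B) s (Z w).
Proof.
move=> /efficiency_bound_representer[s s2 sT].
have sL := representer_L20 s2 sT.
have sZ2 := Lfun2_law Z_law s2.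
pose c := moment s P.
have Ls' := L20_centred s2.
exists (fun z => s z - c) => // B mB.
have B2 := @Lfun_indic _ _ _ eta0 _ mB; have Ba2 := Lfun2_law alpha_law B2.
have c2 t : cst t \in Lfun eta0 2%:E by exact: Lfun_cst.
have c2' t : cst t \in Lfun Pr 2%:E by exact: Lfun_cst.
(* Test function 1_B - eta0(B). On the left the constant drops out because r_phi has mean zero; on
   the right it produces eta0(B) E[s(Z)], which is what centring [s] absorbs. *)
have := sL _ (L20_centred B2).
rewrite moment_indic//; set p := fine (eta0 B).
rewrite ipC (ipBl B2 (c2 p) rphi2) (ipBl Ba2 (c2' p) sZ2).
rewrite /= !RintegralZl//; last 2 first.
- by apply/Lfun1_integrable; exact: Lfun2_Lfun1.
- by apply/Lfun1_integrable; exact: Lfun2_Lfun1.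
have -> : \int[eta0]_x rphi x = 0.
  by have [_] := L20_centred r2; rewrite Rintegral_moment /moment => ->.
have -> : \int[Pr]_x s (Z x) = c.
  rewrite -(Rintegral_law Z_law) ?Rintegral_moment//.
  by apply/Lfun1_integrable; exact: Lfun2_Lfun1.
rewrite mulr0 subr0 => rB.
rewrite Rintegral_indicM rB [RHS]Rintegral_indicM.
rewrite (_ : \1_(alpha @^-1` B) = \1_B \o alpha) //.
rewrite [RHS](ipC Pr) (ipBl sZ2 (c2' c) Ba2) /= RintegralZl//; last first.
  by apply/Lfun1_integrable; exact: Lfun2_Lfun1.
rewrite -(Rintegral_law alpha_law) ?Rintegral_moment ?moment_indic//; last first.
  by apply/Lfun1_integrable; exact: Lfun2_Lfun1.
by rewrite -!Rintegral_moment (ipC Pr) mulrC.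
Qed.

End representer.

(** * Conditional expectations through the density of Z given alpha *)

Lemma ge0_integral_mrestr d (T : measurableType d) (R : realType)
  (mu : {measure set T -> \bar R}) (D : set T) (mD : measurable D)
  (h : T -> \bar R) : measurable_fun setT h -> (forall x, 0 <= h x)%E ->
  (\int[mrestr mu mD]_x h x = \int[mu]_(x in D) h x)%E.
Proof.
move=> mh h0.
rewrite (@ge0_negligible_integral _ _ _ (mrestr mu mD) _ (~` D))//; last 2 first.
- exact: measurableC.
- by rewrite /= /mrestr setICl measure0.
rewrite setDE setCK setTI; apply: eq_measure_integral => B _ BD.
by rewrite /= /mrestr setIidl.
Qed.

Section joint_density.
Context d0 d1 d2 (Omega : measurableType d0) (T : measurableType d1)
  (TZ : measurableType d2) (R : realType) (Pr : probability Omega R).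
Variables (alpha : {mfun Omega >-> T}) (Z : {mfun Omega >-> TZ}).
Variables (eta0 : probability T R) (P : probability TZ R).
Variable mu : {sigma_finite_measure set TZ -> \bar R}.
Variables (A : set T) (f : T -> TZ -> R).
Hypothesis mA : measurable A.
Hypothesis eta0A : eta0 A = 1%E.
Hypothesis Z_law : P = distribution Pr Z :> (set TZ -> \bar R).
Hypothesis mf : measurable_fun (A `*` [set: TZ])
  (fun x : T * TZ => f x.1 x.2).
Hypothesis f0 : forall a z, A a -> 0 <= f a z.
Hypothesis f_cond : forall (B : set T) (C : set TZ),
  measurable B -> measurable C ->
  (Pr (alpha @^-1` B `&` Z @^-1` C) =
   \int[eta0]_(a in B `&` A) \int[mu]_(z in C) (f a z)%:E)%E.

(** Extension by zero: [f] is measurable and nonnegative only over [A], while the mixture results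
    ask for this on the whole product. *)
Let ft := (fun x : T * TZ => f x.1 x.2) \_ (A `*` [set: TZ]).

Let mft : measurable_fun setT ft.
Proof.
have mAT : measurable (A `*` [set: TZ]) by exact: measurableX.
exact: (measurable_restrictT _ mAT).1.
Qed.

Let ftE a z : A a -> ft (a, z) = f a z.
Proof. by move=> Aa; rewrite /ft patchE mem_set. Qed.

Let ft0 x : 0 <= ft x.
Proof.
by rewrite /ft patchE; case: ifPn => // /set_mem[Ax _]; exact: f0.
Qed.

Lemma measurable_conditional_density a : A a -> measurable_fun setT (f a).
Proof.
move=> Aa; rewrite (_ : f a = fun z => ft (a, z)); last first.
  by apply/funext => z; rewrite ftE.
exact: measurableT_comp.
Qed.

Lemma measurable_conditional_integral (h : TZ -> R) :
  measurable_fun setT h -> (forall z, 0 <= h z) ->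
  measurable_fun A (fun a => \int[mu]_z (h z * f a z)%:E)%E.
Proof.
move=> mh h0.
apply: (eq_measurable_fun (fun a => \int[mu]_z (h z * ft (a, z))%:E)%E).
  by move=> a /set_mem Aa; apply: eq_integral => z _; rewrite ftE.
exact/measurable_funTS/measurable_partial_integral.
Qed.

Lemma joint_integral (B : set T) (h : TZ -> R) : measurable B ->
  measurable_fun setT h -> (forall z, 0 <= h z) ->
  (\int[Pr]_(w in alpha @^-1` B) (h (Z w))%:E =
   \int[eta0]_(a in B `&` A) \int[mu]_z (h z * f a z)%:E)%E.
Proof.
move=> mB mh h0.
have mD : measurable (alpha @^-1` B).
  by rewrite -[_ @^-1` _]setTI; exact: measurable_funP.
have mEhZ : measurable_fun setT (fun w => (h (Z w))%:E).
  by apply/measurable_EFinP; exact: measurableT_comp.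
rewrite -(ge0_integral_mrestr Pr mD)//; last by move=> w; rewrite lee_fin.
rewrite -(@ge0_integral_pushforward _ _ _ _ _ Z _ (mrestr Pr mD) setT
  (EFin \o h))//.
rewrite (@integral_mixture _ _ _ _ _ eta0 mu ft (B `&` A))//.
- apply: eq_integral => a /set_mem[_ Aa].
  by apply: eq_integral => z _; rewrite ftE.
- exact: measurableI.
- move=> C mC; rewrite /= /pushforward /mrestr setIC f_cond//.
  apply: eq_integral => a /set_mem[_ Aa].
  by apply: eq_integral => z _; rewrite ftE.
- exact/measurable_EFinP.
- by move=> z _; rewrite lee_fin h0.
Qed.

(** Both sides have equal integrals over every measurable subset of [A], which has full measure.
    Since [joint_integral] covers nonnegative functions, [s] is split into two parts, each at most
    |s|, so that the integrals are finite and may be subtracted. *)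
Lemma conditional_expectation_density (g : T -> R) (s : TZ -> R) :
  eta0.-integrable setT (EFin \o g) -> P.-integrable setT (EFin \o s) ->
  (forall B, measurable B ->
    \int[eta0]_(a in B) g a = \int[Pr]_(w in alpha @^-1` B) s (Z w)) ->
  {ae eta0, forall a, (g a)%:E = (\int[mu]_z (s z * f a z)%:E)%E}.
Proof.
move=> ig is_ gs.
have ms : measurable_fun setT s by apply/measurable_EFinP; exact: measurable_int is_.
have isZ := integrable_law Z_law is_.
pose sp z := Num.max (s z) 0; pose sn z := Num.max (- s z) 0.
have sp0 z : 0 <= sp z by rewrite le_max lexx orbT.
have sn0 z : 0 <= sn z by rewrite le_max lexx orbT.
have msp : measurable_fun setT sp by exact: measurable_maxr.
have msn : measurable_fun setT sn.
  by apply: measurable_maxr => //; exact: measurableT_comp.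
pose p a := (\int[mu]_z (sp z * f a z)%:E)%E.
pose q a := (\int[mu]_z (sn z * f a z)%:E)%E.
(* An extended integral is by definition the difference of those of its positive and negative parts,
   and f >= 0 lets these be taken on [s] alone; so this holds pointwise on [A], even where both are
   infinite. *)
have pq a : A a -> (\int[mu]_z (s z * f a z)%:E = p a - q a)%E.
  move=> Aa; rewrite integralE; congr (_ - _)%E; apply: eq_integral => z _.
    rewrite funeposE -EFin_max /sp maxr_pMl ?mul0r//.
    exact: f0.
  rewrite funenegE -EFinN -EFin_max /sn maxr_pMl ?mul0r ?mulNr//.
  exact: f0.
have ilt (u : TZ -> R) (E : set T) : measurable E -> measurable_fun setT u ->
    (forall z, 0 <= u z <= `|s z|) ->
    Pr.-integrable (alpha @^-1` E) (fun w => (u (Z w))%:E).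
  move=> mE mu_ us.
  have mD : measurable (alpha @^-1` E).
    by rewrite -[_ @^-1` _]setTI; exact: measurable_funP.
  apply: (@le_integrable _ _ _ Pr _ mD _ (fun w => (s (Z w))%:E)).
  - by apply/measurable_EFinP/measurable_funTS; exact: measurableT_comp.
  - move=> w _; have /andP[u0 us_] := us (Z w).
    by rewrite lee_fin ger0_norm.
  - exact: integrableS isZ.
have sps z : 0 <= sp z <= `|s z|.
  by rewrite sp0 /sp ge_max ler_norm normr_ge0.
have sns z : 0 <= sn z <= `|s z|.
  by rewrite sn0 /sn ge_max normr_ge0 -normrN ler_norm.
have intE (u : TZ -> R) E : measurable E -> E `<=` A -> measurable_fun setT u ->
    (forall z, 0 <= u z <= `|s z|) ->
    eta0.-integrable E (fun a => \int[mu]_z (u z * f a z)%:E)%E /\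
    (\int[eta0]_(a in E) (\int[mu]_z (u z * f a z)%:E) =
     \int[Pr]_(w in alpha @^-1` E) (u (Z w))%:E)%E.
  move=> mE EA mu_ us; have u0 z : 0 <= u z by case/andP: (us z).
  have e : (\int[eta0]_(a in E) (\int[mu]_z (u z * f a z)%:E) =
     \int[Pr]_(w in alpha @^-1` E) (u (Z w))%:E)%E.
    by rewrite joint_integral// setIidl.
  split => //; apply/integrableP; split.
    by apply: measurable_funS (measurable_conditional_integral mu_ u0).
  rewrite (_ : (\int[eta0]_(x in E) _)%E =
    (\int[eta0]_(a in E) (\int[mu]_z (u z * f a z)%:E))%E).
    rewrite e; have /integrableP[_] := ilt u E mE mu_ us.
    by under eq_integral do rewrite abse_EFin ger0_norm//.
  apply: eq_integral => a /set_mem Ea; rewrite gee0_abs//.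
  apply: integral_ge0 => z _; rewrite lee_fin mulr_ge0// f0//.
  exact: EA.
have [ip_ _] := intE sp A mA (@subset_refl _ _) msp sps.
have [iq_ _] := intE sn A mA (@subset_refl _ _) msn sns.
have gpq : ae_eq eta0 A (EFin \o g) (p \- q)%E.
  apply: integral_ae_eq => //.
  - exact: integrableS ig.
  - exact: (measurable_int _ (integrableB mA ip_ iq_)).
  - move=> E EA mE.
    have mD : measurable (alpha @^-1` E).
      by rewrite -[_ @^-1` _]setTI; exact: measurable_funP.
    have [ipE pE] := intE sp E mE EA msp sps.
    have [iqE qE] := intE sn E mE EA msn sns.
    rewrite integralB// pE qE -integralB//; [|exact: ilt..].
    have i1 : (\int[eta0]_(x in E) (EFin \o g) x \is a fin_num)%E.
      by apply: integrable_fin_num => //; exact: integrableS ig.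
    have i2 : (\int[Pr]_(w in alpha @^-1` E) (s (Z w))%:E \is a fin_num)%E.
      by apply: integrable_fin_num => //; exact: integrableS isZ.
    transitivity (\int[Pr]_(w in alpha @^-1` E) (s (Z w))%:E)%E.
      by rewrite -(fineK i1) -(fineK i2); congr EFin; exact: gs.
    apply: eq_integral => w _; rewrite -EFinB; congr EFin.
    by rewrite /sp /sn; case: (leP (s (Z w)) 0); case: (leP (- s (Z w)) 0); lra.
have nA : {ae eta0, forall a, A a}.
  exists (~` A); split => //; first exact: measurableC.
  by rewrite probability_setC// eta0A subee.
by apply: filterS2 gpq nA => a gpqa Aa; rewrite pq//; exact: gpqa.
Qed.

End joint_density.

(** * Borel sets, supports and approach sequences *)

Lemma borel_rV_open (R : realType) (n : nat) (U : set 'rV[R]_n) :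
  open U -> measurable (U : set (borel_rV R n)).
Proof. exact: sub_sigma_algebra. Qed.

Lemma borel_rV_closed (R : realType) (n : nat) (U : set 'rV[R]_n) :
  closed U -> measurable (U : set (borel_rV R n)).
Proof.
move=> cU; rewrite -(setCK U); apply: (@measurableC _ (borel_rV R n)).
by apply: borel_rV_open; exact: closed_openC.
Qed.

Lemma closed_msupport (R : realType) (n : nat)
  (eta : {measure set (borel_rV R n) -> \bar R}) : closed (msupport eta).
Proof.
move=> a aC U oU Ua.
by have [b [sb Ub]] := aC U (open_nbhs_nbhs (conj oU Ua)); exact: sb.
Qed.

(** Otherwise [U] would lie in a null set, although it is an open neighbourhood of a support
    point. *)
Lemma ae_meets_open (R : realType) (n : nat)
  (eta : {measure set (borel_rV R n) -> \bar R}) (G : set 'rV[R]_n)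
  (U : set 'rV[R]_n) (a : 'rV[R]_n) :
  {ae eta, forall x, G x} -> open U -> U a -> msupport eta a ->
  exists2 x, U x & G x.
Proof.
move=> [N [mN N0 GN]] oU Ua sa; apply: contrapT => noGU.
have UN : U `<=` N.
  by move=> x Ux; apply: GN => /= Gx; apply: noGU; exists x.
have := sa U oU Ua; rewrite lt_neqAle eq_sym => /andP[/negP + _]; apply.
rewrite eq_le measure_ge0 andbT -N0 le_measure ?inE//.
exact: borel_rV_open.
Qed.

Lemma ae_sequence_to (R : realType) (n : nat)
  (eta : {measure set (borel_rV R n) -> \bar R}) (G : set 'rV[R]_n)
  (O W : set 'rV[R]_n) (a : 'rV[R]_n) :
  {ae eta, forall x, G x} -> open O -> nbhs a W -> W `<=` msupport eta ->
  (forall e : R, 0 < e -> exists2 x, O x & ball a e x) ->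
  exists u : nat -> 'rV[R]_n,
    u @ \oo --> a /\ forall k, [/\ O (u k), W (u k) & G (u k)].
Proof.
move=> aeG oO aW Wsupp aO.
have /choice[u uP] : forall k : nat, exists x : 'rV[R]_n,
    [/\ O x, W x, G x & ball a k.+1%:R^-1 x].
  (* Two choices follow: [x] only shows that the open set [O]&[V] contains a support point, and then
     [y] is taken in that set where [G] holds. *)
  move=> k; pose V := (W `&` ball a (k.+1%:R^-1 : R))^°.
  have aV : nbhs a V.
    apply: open_nbhs_nbhs; split; first exact: open_interior.
    by apply: filterI => //; apply: nbhsx_ballx; rewrite invr_gt0.
  have [e /= e0 aeV] : exists2 e : R, 0 < e & ball a e `<=` V by exact/nbhs_ballP.
  have [x Ox axe] := aO e e0.
  have Vx := aeV _ axe.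
  have [||y [Oy Vy] Gy] := @ae_meets_open R n eta G (O `&` V) x aeG _ (conj Ox Vx).
  - by apply: openI => //; exact: open_interior.
  - by apply: Wsupp; have [] := interior_subset Vx.
  - by have [Wy bay] := interior_subset Vy; exists y.
exists u; split; last by move=> k; have [] := uP k.
apply/cvg_ballP => e e0; near=> k.
have [_ _ _] := uP k; apply: le_ball; near: k.
by apply: filterS (near_infty_natSinv_lt (PosNum e0)) => k; exact: ltW.
Unshelve. all: by end_near. Qed.

(* The integral of a nonnegative function is a supremum over the simple
   functions below it, so it is monotone even without measurability. *)
Lemma ge0_le_integralT d (T : measurableType d) (R : realType)
  (mu : {measure set T -> \bar R}) (g h : T -> \bar R) :
  (forall x, 0 <= g x)%E -> (forall x, g x <= h x)%E ->
  (\int[mu]_x g x <= \int[mu]_x h x)%E.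
Proof.
move=> g0 gh; have h0 x : (0 <= h x)%E := le_trans (g0 x) (gh x).
rewrite !ge0_integralTE//; apply: ereal_sup_le => _ [k kg <-].
by exists k => // x; exact: le_trans (kg x) (gh x).
Qed.

Lemma closed_cdf_set (R : realType) (n : nat) (ar : 'rV[R]_n) :
  closed [set a : 'rV[R]_n | forall i, a ord0 i <= ar ord0 i].
Proof.
rewrite (_ : [set _ | _] = \bigcap_i [set a : 'rV[R]_n | a ord0 i <= ar ord0 i]).
  apply: closed_bigI => i _.
  apply: (@preimage_closed _ _ (fun a : 'rV[R]_n => a ord0 i)
    [set x | x <= ar ord0 i]).
    by move=> x _; exact: coord_continuous.
  exact: closed_le.
by apply/seteqP; split=> [a ha i _|a ha i]; exact: ha.
Qed.

Lemma cdf_atE (R : realType) (n : nat) (ar : 'rV[R]_n) :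
  cdf_at ar = \1_[set a : 'rV[R]_n | forall i, a ord0 i <= ar ord0 i].
Proof.
apply/funext => a; rewrite /cdf_at indicE; congr (nat_of_bool _)%:R.
by apply/idP/idP => [/forallP h|/set_mem h]; [exact/mem_set|exact/forallP].
Qed.

(** * Dominated convergence in the heterogeneity parameter *)

Section dominated_limit.
Context (R : realType) (n : nat) d (TZ : measurableType d).
Variables (mu : {measure set TZ -> \bar R}).
Variables (f : 'rV[R]_n -> TZ -> R) (Gamma : set 'rV[R]_n) (s : TZ -> R).

Lemma dominated_limit (a : 'rV[R]_n) (u : nat -> 'rV[R]_n) :
  measurable_fun setT s ->
  (forall b, Gamma b -> measurable_fun setT (f b)) ->
  (forall b z, Gamma b -> 0 <= f b z) ->
  Gamma a -> (forall k, Gamma (u k)) -> u @ \oo --> a ->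
  {ae mu, forall z, f b z @[b --> a] --> f a z} ->
  (\int[mu]_z (`|s z|%:E * ereal_sup [set (f b z)%:E | b in Gamma]) < +oo)%E ->
  (\int[mu]_z (s z * f (u k) z)%:E @[k --> \oo] --> \int[mu]_z (s z * f a z)%:E)%E.
Proof.
move=> ms mf f0 Ga Gu ua fc dom.
pose fk k z := (s z * f (u k) z)%:E.
(* The supremum over [Gamma] is uncountable and possibly not measurable; the one along the sequence
   is measurable and lies below it. *)
pose g z := esups (fun k => `|fk k z|%E) 0%N.
have mfk k : measurable_fun setT (fk k).
  by apply/measurable_EFinP/measurable_funM => //; exact: mf.
have mg : measurable_fun setT g.
  by apply: measurable_fun_esups => k; exact: measurableT_comp.
have fkg k z : (`|fk k z| <= g z)%E by apply: ereal_sup_ubound; exists k.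
have g0 z : (0 <= g z)%E by exact: le_trans (fkg 0%N z).
have [||||_ _ //] := @dominated_convergence _ _ _ mu setT measurableT fk
  (fun z => (s z * f a z)%:E) g mfk.
- by apply/measurable_EFinP/measurable_funM => //; exact: mf.
- apply: filterS fc => z fz _; apply: cvg_EFin; first exact: nearW.
  rewrite /comp /=; apply: cvgM; first exact: cvg_cst.
  exact: (cvg_comp _ _ ua fz).
- apply/integrableP; split => //; apply: le_lt_trans dom.
  under eq_integral do rewrite gee0_abs//.
  apply: ge0_le_integralT => // z; apply: ge_ereal_sup => _ [k _ <-].
  rewrite /fk abse_EFin normrM EFinM (ger0_norm (f0 _ _ (Gu k))).
  rewrite lee_wpmul2l ?lee_fin//; apply: ereal_sup_ubound.
  by exists (u k).
- by apply: nearW => z k _.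
Qed.

End dominated_limit.

(** * Two incompatible limits at [alpha_r] *)

Theorem corollary3p1 (R : realType) (n : nat) (n_gt0 : (0 < n)%N)
  (dO dZ : measure_display)
  (Omega : measurableType dO) (TZ : measurableType dZ)
  (Pr : probability Omega R)
  (alpha : {mfun Omega >-> borel_rV R n}) (Z : {mfun Omega >-> TZ})
  (mu : {sigma_finite_measure set TZ -> \bar R})
  (H : set (probability (borel_rV R n) R))
  (eta0 : probability (borel_rV R n) R)
  (P : probability TZ R)
  (A : set (borel_rV R n)) (f : borel_rV R n -> TZ -> R)
  (alpha_law : eta0 = distribution Pr alpha :> (set (borel_rV R n) -> \bar R))
  (Z_law : P = distribution Pr Z :> (set TZ -> \bar R))
  (A_support : A = msupport eta0)
  (H_eta0 : H eta0)
  (H_on_A : forall eta : probability (borel_rV R n) R, H eta -> eta A = 1%E)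
  (f_measurable : measurable_fun (A `*` [set: TZ])
     (fun x : borel_rV R n * TZ => f x.1 x.2))
  (f_ge0 : forall a z, A a -> 0 <= f a z)
  (f_int1 : forall a, A a -> (\int[mu]_z (f a z)%:E = 1)%E)
  (f_cond_density :
     forall (B : set (borel_rV R n)) (C : set TZ),
       measurable B -> measurable C ->
       (Pr (alpha @^-1` B `&` Z @^-1` C) =
        \int[eta0]_(a in B `&` A) \int[mu]_(z in C) (f a z)%:E)%E)
  (P_density : forall C : set TZ, measurable C ->
     P C = (\int[mu]_(z in C) mixture_density A f eta0 z)%E)
  (UH_nonparametric : nonparametric H eta0)
  (N : set 'rV[R]_n) (N_open : open N) (NA : N `<=` A)
  (alpha_r : 'rV[R]_n) (N_alpha_r : N alpha_r)
  (f_continuous : {ae mu, forall z, forall a : 'rV[R]_n, N a ->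
     f a' z @[a' --> a] --> f a z})
  (f_dominated : forall a : 'rV[R]_n, N a ->
     exists Gamma0 : set 'rV[R]_n, [/\ nbhs a Gamma0, Gamma0 `<=` N &
       forall s : TZ -> R, L20 P s ->
         {ae eta0, forall a' : borel_rV R n,
            ((cdf_at alpha_r a' - moment (cdf_at alpha_r) eta0)%:E =
             \int[mu]_z (s z * f a' z)%:E)%E} ->
         (\int[mu]_z (`|s z|%:E *
            ereal_sup [set (f a' z)%:E | a' in Gamma0]) < +oo)%E]) :
  ~ regularly_identified mu A f Pr alpha Z H eta0 (cdf_at alpha_r).
Proof.
move=> [_ bound_lty].
set r := cdf_at alpha_r in bound_lty f_dominated *.
pose Q := [set a : 'rV[R]_n | forall i, a ord0 i <= alpha_r ord0 i].
have cQ : closed Q by exact: closed_cdf_set.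
have rE : r = \1_Q by exact: cdf_atE.
have mA : measurable A.
  by rewrite A_support; apply: borel_rV_closed; exact: closed_msupport.
have r2 : r \in Lfun eta0 2%:E.
  by rewrite rE; apply: (@Lfun_indic _ (borel_rV R n)); exact: borel_rV_closed.
have [s Ls sB] := centred_representer alpha_law Z_law r2 UH_nonparametric bound_lty.
have ms : measurable_fun setT s by exact: Lfun_measurable Ls.1.
have aeE : {ae eta0, forall a : borel_rV R n,
    ((r a - moment r eta0)%:E = \int[mu]_z (s z * f a z)%:E)%E}.
  apply: (conditional_expectation_density mA (H_on_A _ H_eta0) Z_law
    f_measurable f_ge0 f_cond_density _ _ sB).
  - by apply/Lfun1_integrable; apply: Lfun2_Lfun1; exact: (L20_centred r2).1.
  - by apply/Lfun1_integrable; apply: Lfun2_Lfun1; exact: Ls.1.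
have [Gamma [nGamma GammaN dom]] := f_dominated _ N_alpha_r.
have GammaA : Gamma `<=` A by move=> a /GammaN/NA.
have limit_value (O : set 'rV[R]_n) (c : R) : open O ->
    (forall e : R, 0 < e -> exists2 x, O x & ball alpha_r e x) ->
    (forall x, O x -> r x = c) ->
    (\int[mu]_z (s z * f alpha_r z)%:E = (c - moment r eta0)%:E)%E.
  move=> oO aO rO.
  have [u [ua uP]] : exists u : nat -> 'rV[R]_n, u @ \oo --> alpha_r /\
      forall k, [/\ O (u k), Gamma (u k) &
        ((r (u k) - moment r eta0)%:E = \int[mu]_z (s z * f (u k) z)%:E)%E].
    by apply: (ae_sequence_to aeE) => //; rewrite -A_support.
  have lim_u : (\int[mu]_z (s z * f (u k) z)%:E @[k --> \oo] -->
      \int[mu]_z (s z * f alpha_r z)%:E)%E.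
    apply: (dominated_limit (Gamma := Gamma)) => //.
    - move=> b /GammaA Ab.
      exact: (measurable_conditional_density mA f_measurable Ab).
    - by move=> b z /GammaA; exact: f_ge0.
    - exact: nbhs_singleton.
    - by move=> k; have [] := uP k.
    - by apply: filterS f_continuous => z; exact.
    - exact: dom.
  apply/esym/(cvg_unique _ _ lim_u) => //.
  apply: cvg_near_cst; apply: nearW => k.
  by have [Ok _ <-] := uP k; rewrite rO.
have below : (\int[mu]_z (s z * f alpha_r z)%:E = (1 - moment r eta0)%:E)%E.
  (* The interior replaces the closed set [Q] because only an open set is sure to meet the a.e. set;
     moving all coordinates down by e/2 leaves room for a ball of that radius. *)
  apply: (limit_value Q^°).
  - exact: open_interior.
  - move=> e e0; exists (alpha_r - const_mx (e / 2)).
      apply/nbhs_ballP; exists (e / 2) => /=; first exact: divr_gt0.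
      move=> y [_ yball] i; have := yball ord0 i.
      by rewrite /ball /= !mxE => /ltr_distlCDr; lra.
    by split => // i j; rewrite /ball /= !mxE opprB addrC subrK gtr0_norm; lra.
  - move=> x /interior_subset Qx; rewrite rE indicE mem_set//.
have above : (\int[mu]_z (s z * f alpha_r z)%:E = (0 - moment r eta0)%:E)%E.
  apply: (limit_value (~` Q)).
  - exact: closed_openC.
  (* Leaving [Q] takes one coordinate that exceeds its bound, and [n_gt0] provides it; in dimension
     0 the set [Q] is the whole space. *)
  - move=> e e0; exists (alpha_r + const_mx (e / 2)).
      move=> /(_ (Ordinal n_gt0)); rewrite !mxE; lra.
    split => // i j; rewrite /ball /= !mxE opprD addrA subrr sub0r normrN.
    by rewrite gtr0_norm; lra.
  - by move=> x nQx; rewrite rE indicE memNset.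
by move: below; rewrite above => -[]; lra.
Qed.
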